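(* Up to isomorphism, there are exactly $3$ classes of locally equienergetic graphs of order $6$, namely: (i) $\{K_6,\ K_4\cup K_2,\ K_3\cup K_3,\ K_2\cup K_2\cup K_2\}$, with $e(K_6)=e(K_4\cup K_2)=e(K_3\cup K_3)=e(K_2\cup K_2\cup K_2)$; (ii) $\{K_5\cup K_1,\ K_3\cup K_2\cup K_1,\ C_5\cup K_1\}$, with $e(K_5\cup K_1)=e(K_3\cup K_2\cup K_1)=e(C_5\cup K_1)$; (iii) $\{K_4\cup K_1\cup K_1,\ K_2\cup K_2\cup K_1\cup K_1\}$, with $e(K_4\cup K_1\cup K_1)=e(K_2\cup K_2\cup K_1\cup K_1)$.
   Context: For a finite simple undirected graph $G$ with vertices $v_1,\dots,v_n$, the adjacency matrix $A(G)$ has $(i,j)$ entry $1$ if $v_i,v_j$ are adjacent and $0$ otherwise. The energy $\mathscr{E}(G)$ is the sum of the absolute values of the eigenvalues of $A(G)$ (counted with multiplicity); the graph with no vertices has energy $0$. For a vertex $v$ of $G$, let $G^{v}$ be the graph obtained from $G$ by deleting $v$. The local energy of $G$ at $v$ is $\mathscr{E}_G(v)=\mathscr{E}(G)-\mathscr{E}(G^{v})$, and the local energy of $G$ is $e(G)=\sum_{v\in V(G)}\mathscr{E}_G(v)$. Two (non-isomorphic) graphs of the same order are locally equienergetic if they have the same local energy. A class of locally equienergetic graphs of order $n$ is the set of all isomorphism classes of finite simple undirected (possibly disconnected) graphs of order $n$ having a given common value of $e$, provided this set has at least two elements. $K_m$ is the complete graph and $C_m$ the cycle on $m$ vertices;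 $\cup$ is disjoint union. *)

(* Defs.v *)
From HB Require Import structures.
From mathcomp Require Import all_boot all_order all_algebra.
From mathcomp Require Import complex.

Set Implicit Arguments.
Unset Strict Implicit.
Unset Printing Implicit Defensive.

Import Order.TTheory GRing.Theory Num.Theory.

Local Open Scope ring_scope.

(* A simple undirected graph on the vertex type T, given by its adjacency      *)
(* relation as a set of ordered pairs; this makes the graphs on T a finType.   *)
Definition simple_edges (T : finType) (E : {set T * T}) : bool :=
  [forall x, (x, x) \notin E] &&
  [forall x, forall y, ((x, y) \in E) == ((y, x) \in E)].

Record sgraph (T : finType) : Type := SGraph {
  sgraph_edges : {set T * T};
  sgraph_simple : simple_edges sgraph_edges
}.

HB.instance Definition _ (T : finType) := [isSub for @sgraph_edges T].
HB.instance Definition _ (T : finType) := [Finite of sgraph T by <:].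

Definition adj (T : finType) (G : sgraph T) : rel T :=
  fun x y => (x, y) \in sgraph_edges G.

Lemma graph_of_subproof (T : finType) (e : rel T) :
  simple_edges [set p : T * T | (p.1 != p.2) && (e p.1 p.2 || e p.2 p.1)].
Proof.
apply/andP; split; first by apply/forallP => x; rewrite inE eqxx.
apply/forallP => x; apply/forallP => y.
by rewrite !inE /= (eq_sym x) orbC eqxx.
Qed.

(* The graph in which distinct x and y are adjacent iff e x y or e y x. *)
Definition graph_of (T : finType) (e : rel T) : sgraph T :=
  SGraph (graph_of_subproof e).

Definition complete_graph (m : nat) : sgraph 'I_m := graph_of (fun _ _ => true).

(* [ordS i] is i + 1 modulo m; this is the m-cycle for m >= 3. *)
Definition cycle_graph (m : nat) : sgraph 'I_m :=
  graph_of (fun i j => ordS i == j).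

Definition disjoint_union (T U : finType) (G : sgraph T) (H : sgraph U) :
    sgraph (T + U)%type :=
  graph_of (fun a b : T + U => match a, b with
                               | inl x, inl y => adj G x y
                               | inr x, inr y => adj H x y
                               | _, _ => false
                               end).

Definition delete_vertex (T : finType) (G : sgraph T) (v : T) :
    sgraph {x : T | x != v} :=
  graph_of (fun x y : {x : T | x != v} => adj G (val x) (val y)).

Definition graph_iso (T U : finType) (G : sgraph T) (H : sgraph U) : bool :=
  [exists f : {ffun T -> U},
     [&& injectiveb f, #|T| == #|U| &
         [forall x, forall y, adj H (f x) (f y) == adj G x y]]].

(* The isomorphism class of H, represented inside the graphs on {0, ..., n-1}; *)
(* it is empty when H does not have order n.                                   *)
Definition iso_class (n : nat) (U : finType) (H : sgraph U) :
    {set sgraph 'I_n} :=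
  [set G | graph_iso G H].

Definition adjacency_matrix (R : pzSemiRingType) (T : finType) (G : sgraph T) :
    'M[R]_#|T| :=
  \matrix_(i, j) (adj G (enum_val i) (enum_val j))%:R.

(* The complex eigenvalues of A, repeated according to multiplicity: the       *)
(* sequence s such that char_poly A = \prod_(z <- s) ('X - z%:P).              *)
Definition eigenvalues (R : rcfType) (n : nat) (A : 'M[R[i]]_n) : seq R[i] :=
  sval (closed_field_poly_normal (char_poly A)).

Section Energy.
Variable R : rcfType.

(* [ComplexField.Normc.normc] is the modulus of a complex number, as an        *)
(* element of R.                                                               *)
Definition energy (T : finType) (G : sgraph T) : R :=
  \sum_(z <- eigenvalues (adjacency_matrix R[i] G)) ComplexField.Normc.normc z.

Definition local_energy_at (T : finType) (G : sgraph T) (v : T) : R :=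
  energy G - energy (delete_vertex G v).

Definition local_energy (T : finType) (G : sgraph T) : R :=
  \sum_(v : T) local_energy_at G v.

Definition classes_with_local_energy (n : nat) (a : R) :
    {set {set sgraph 'I_n}} :=
  [set iso_class n G | G : sgraph 'I_n & local_energy G == a].

(* Only the values attained as the local energy of some graph need to be       *)
(* considered: for any other value the set of isomorphism classes is empty.    *)
Definition locally_equienergetic_classes (n : nat) :
    {set {set {set sgraph 'I_n}}} :=
  [set X in [set classes_with_local_energy n (local_energy G) |
              G : sgraph 'I_n]
  | (2 <= #|X|)%N].

End Energy.

Notation "''K_' m" := (complete_graph m) (at level 8, m at level 2).
Notation "''Cyc_' m" := (cycle_graph m) (at level 8, m at level 2).
Notation "G ∪ H" := (disjoint_union G H) (at level 50, left associativity).

(* Main.v *)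
Require Import Defs.
From Stdlib Require Import ZArith.
From mathcomp Require Import all_boot all_order all_algebra.
From mathcomp Require Import perm boolp reals complex polyrcf ssrZ ring lra.

(** Deleting a vertex from K_m with m >= 2 lowers the energy 2(m - 1) by 2, so a
    disjoint union of complete graphs has local energy twice the number of its
    non-isolated vertices.  The cycle C_5, of energy 2 + 2 sqrt 5, becomes the
    path P_4, of energy 2 sqrt 5, and also loses 2 at each vertex.  This gives
    the local energies 12, 10 and 8 of the three classes, and these equalities
    are proved exactly: the characteristic polynomials involved split into
    factors X - k and X^2 +- X - 1, so all the energies lie in Z + Z sqrt 5
    ([local_energy_exact], [equienergetic_codes_exact]).

    That nothing else coincides is a finite computation over the 156 graphs of
    order 6.  Among the local energies of non-isomorphic graphs, the smallest
    nonzero difference is about 6.6e-6, hence it suffices to know every local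
    energy to about 1e-6.  An energy is enclosed as follows.  The
    characteristic polynomial is computed with integer coefficients
    ([to_poly_char]) and written as a product of polynomials from a table, each
    of which comes with approximations of its roots.  A polynomial of degree d
    with a root in each of d disjoint intervals, usually shown by a change of
    sign, has no other roots ([certified_spectrum]), and multiple eigenvalues do
    no harm, since they come from repeated factors.  With roots known up to 1e-8, a local
    energy, a combination of 6 * 6 + 6 * 5 eigenvalues, is known up to 66e-8
    ([local_energy_enclosure]).

    The list of 156 graphs is complete because its relabellings exhaust all
    the 2^15 possible upper triangles of an adjacency matrix ([codes_cover]).
    Two graphs with the same local energy are therefore isomorphic to graphs of
    the list whose approximate local energies are within 132e-8 of each other,
    and inspection leaves only the nine graphs of the statement
    ([same_local_energy]).  The graphs in one class differ by their numbers of
    edges, so they are not isomorphic. *)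

Set Implicit Arguments.
Unset Strict Implicit.
Unset Printing Implicit Defensive.

Import Order.TTheory GRing.Theory Num.Theory.

(** * Graph isomorphism *)

Lemma adj_sym (T : finType) (G : sgraph T) x y : adj G x y = adj G y x.
Proof.
by case: G => E /= sE; case/andP: (sE) => _ /forallP/(_ x)/forallP/(_ y)/eqP.
Qed.

Lemma adj_irr (T : finType) (G : sgraph T) x : adj G x x = false.
Proof. by case: G => E /= sE; case/andP: (sE) => /forallP/(_ x)/negbTE. Qed.

Lemma adj_graph_of (T : finType) (e : rel T) x y :
  adj (graph_of e) x y = (x != y) && (e x y || e y x).
Proof. by rewrite /adj /= inE. Qed.

Lemma adj_inj (T : finType) (G H : sgraph T) : adj G =2 adj H -> G = H.
Proof.
by move=> eGH; apply: val_inj; apply/setP => -[x y]; apply: (eGH x y).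
Qed.

Lemma graph_isoP (T U : finType) (G : sgraph T) (H : sgraph U) :
  reflect (exists f : T -> U,
             bijective f /\ forall x y, adj H (f x) (f y) = adj G x y)
          (graph_iso G H).
Proof.
apply: (iffP existsP) => [[f /and3P[/injectiveP f_inj /eqP cTU /forallP fE]]|].
  exists f; split; first by apply: inj_card_bij; rewrite ?cTU.
  by move=> x y; apply/eqP; move/forallP: (fE x); apply.
move=> [f [f_bij fE]]; exists [ffun x => f x]; apply/and3P; split.
- by apply/injectiveP => x y; rewrite !ffunE; apply: (bij_inj f_bij).
- by rewrite (bij_eq_card f_bij).
- by apply/forallP => x; apply/forallP => y; rewrite !ffunE fE.
Qed.

Lemma graph_iso_refl (T : finType) (G : sgraph T) : graph_iso G G.
Proof. by apply/graph_isoP; exists id; split=> //; exists id. Qed.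

Lemma graph_iso_sym (T U : finType) (G : sgraph T) (H : sgraph U) :
  graph_iso G H -> graph_iso H G.
Proof.
move=> /graph_isoP[f [[g fK gK] fE]]; apply/graph_isoP; exists g.
by split=> [|x y]; [exists f | rewrite -fE !gK].
Qed.

Lemma graph_iso_trans (T U V : finType) (G : sgraph T) (H : sgraph U)
    (K : sgraph V) :
  graph_iso G H -> graph_iso H K -> graph_iso G K.
Proof.
move=> /graph_isoP[f [f_bij fE]] /graph_isoP[g [g_bij gE]].
apply/graph_isoP; exists (g \o f); split; first exact: bij_comp.
by move=> x y; rewrite /= gE.
Qed.

Lemma eq_iso_class n (T U : finType) (G : sgraph T) (H : sgraph U) :
  graph_iso G H -> iso_class n G = iso_class n H.
Proof.
move=> GH; apply/setP => K; rewrite !inE.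
apply/idP/idP => /graph_iso_trans; first exact.
by apply; apply: graph_iso_sym.
Qed.

Lemma iso_class_inj n (G : sgraph 'I_n) (U : finType) (H : sgraph U) :
  iso_class n G = iso_class n H -> graph_iso G H.
Proof. by move/setP/(_ G); rewrite !inE graph_iso_refl. Qed.

Definition edge_pairs (T : finType) (G : sgraph T) : nat :=
  \sum_x \sum_y adj G x y.

Lemma edge_pairs_iso (T U : finType) (G : sgraph T) (H : sgraph U) :
  graph_iso G H -> edge_pairs G = edge_pairs H.
Proof.
move=> /graph_isoP[f [f_bij fE]]; rewrite /edge_pairs [RHS](reindex f) /=;
  last exact: onW_bij.
apply: eq_bigr => x _; rewrite [RHS](reindex f) /=; last exact: onW_bij.
by apply: eq_bigr => y _; rewrite fE.
Qed.

(** * Graphs given by relations on natural numbers *)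

Definition adjacent (e : rel nat) : rel nat :=
  fun i j => (i != j) && (e i j || e j i).

Definition ngraph (n : nat) (e : rel nat) : sgraph 'I_n :=
  graph_of (fun i j : 'I_n => e i j).

Lemma adj_ngraph n e (i j : 'I_n) : adj (ngraph n e) i j = adjacent e i j.
Proof. by rewrite adj_graph_of. Qed.

Definition delete (v : nat) (e : rel nat) : rel nat :=
  fun i j => e (bump v i) (bump v j).

Lemma delete_ngraph_iso n e (v : 'I_n.+1) :
  graph_iso (delete_vertex (ngraph n.+1 e) v) (ngraph n (delete v e)).
Proof.
apply: graph_iso_sym; apply/graph_isoP.
have vP i : lift v i != v by rewrite eq_sym neq_lift.
exists (fun i => exist (fun x => x != v) (lift v i) (vP i)); split.
  apply: inj_card_bij => [i j /(congr1 val)/lift_inj //|].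
  by rewrite card_sig cardC1 !card_ord.
move=> i j; rewrite adj_graph_of /= [adj _ (lift v j) _]adj_sym orbb.
rewrite -val_eqE /= (inj_eq (@lift_inj _ v)) !adj_ngraph /adjacent /delete /=.
by rewrite (can_eq (bumpK v)) andbA andbb.
Qed.

Definition sum_rel (m : nat) (a b : rel nat) : rel nat :=
  fun i j => if i < m then (j < m) && a i j else (m <= j) && b (i - m) (j - m).

Lemma disjoint_union_iso (T U : finType) (G : sgraph T) (H : sgraph U) m k a b :
  graph_iso G (ngraph m a) -> graph_iso H (ngraph k b) ->
  graph_iso (G ∪ H) (ngraph (m + k) (sum_rel m a b)).
Proof.
move=> /graph_isoP[f [f_bij fE]] /graph_isoP[g [g_bij gE]].
apply/graph_isoP.
exists (fun z => match z with
                 | inl x => lshift k (f x)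
                 | inr y => rshift m (g y)
                 end); split.
  apply: inj_card_bij => [|]; last first.
    rewrite card_sum card_ord (bij_eq_card f_bij) (bij_eq_card g_bij).
    by rewrite !card_ord.
  move=> [x|x] [y|y] /eqP; rewrite eq_shift //.
    by rewrite (inj_eq (bij_inj f_bij)) => /eqP ->.
  by rewrite (inj_eq (bij_inj g_bij)) => /eqP ->.
have lt_m i : (m + i < m) = false by rewrite ltnNge leq_addr.
have adj_diag (V W : finType) (i : V -> W) (K : sgraph V) x y :
    injective i -> (i x != i y) && (adj K x y || adj K y x) = adj K x y.
  move=> i_inj; rewrite (inj_eq i_inj) [adj K y x]adj_sym orbb.
  by case: eqP => // ->; rewrite adj_irr.
move=> [x|x] [y|y]; rewrite adj_ngraph adj_graph_of /adjacent /sum_rel /=.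
- rewrite !ltn_ord adj_diag; last exact: inl_inj.
  by rewrite -fE adj_ngraph.
- by rewrite lt_m ltn_ord [m <= _]leqNgt ltn_ord /= andbF.
- by rewrite lt_m ltn_ord [m <= _]leqNgt ltn_ord /= andbF.
- rewrite !lt_m !leq_addr !addKn eqn_add2l adj_diag; last exact: inr_inj.
  by rewrite -gE adj_ngraph.
Qed.

Lemma complete_ngraph m : graph_iso 'K_m (ngraph m (fun _ _ => true)).
Proof. exact: graph_iso_refl. Qed.

Lemma cycle_ngraph m : graph_iso 'Cyc_m (ngraph m (fun i j => i.+1 %% m == j)).
Proof. exact: graph_iso_refl. Qed.

Definition count_edge_pairs (n : nat) (e : rel nat) : nat :=
  sumn [seq sumn [seq (adjacent e i j : nat) | j <- iota 0 n] | i <- iota 0 n].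

Lemma edge_pairs_ngraph n e : edge_pairs (ngraph n e) = count_edge_pairs n e.
Proof.
have E : iota 0 n = index_iota 0 n by rewrite /index_iota subn0.
rewrite /count_edge_pairs E.
rewrite sumnE big_map big_mkord; apply: eq_bigr => i _.
by rewrite sumnE big_map big_mkord; apply: eq_bigr => j _; rewrite adj_ngraph.
Qed.

(** A table, because the evaluations below read the entries of [a] many times
    and should compute each of them once. *)
Definition tabulate (T : Type) (x : T) n (a : nat -> nat -> T) :=
  let M := mkseq (fun i => mkseq (a i) n) n in
  fun i j => nth x (nth [::] M i) j.

Lemma tabulateE (T : Type) (x : T) n a i j :
  i < n -> j < n -> tabulate x n a i j = a i j.
Proof. by move=> ltin ltjn; rewrite /tabulate nth_mkseq // nth_mkseq. Qed.

(** * Energy and local energy as isomorphism invariants *)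

Local Open Scope ring_scope.

(** The two orders are only propositionally equal, as happens for the
    cardinals of two isomorphic vertex types; a reindexing acts on the
    characteristic matrix by the same permutation on rows and columns, whose
    signs cancel. *)
Lemma char_poly_reindex (F : comNzRingType) m n (f : 'I_m -> 'I_n)
    (A : 'M[F]_m) (B : 'M[F]_n) :
  m = n -> injective f -> (forall i j, A i j = B (f i) (f j)) ->
  char_poly A = char_poly B.
Proof.
move=> mn; case: n / mn f B => f B f_inj AB; rewrite /char_poly.
pose s := perm f_inj.
have -> : char_poly_mx A = row_perm s (col_perm s (char_poly_mx B)).
  apply/matrixP => i j; rewrite !mxE AB !permE.
  by rewrite (inj_eq f_inj).
rewrite row_permE col_permE !det_mulmx !det_perm.
by rewrite odd_permV mulrCA -signr_addb addbb expr0 mulr1.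
Qed.

Lemma delete_vertex_iso (T U : finType) (G : sgraph T) (H : sgraph U)
    (f : T -> U) (v : T) :
  bijective f -> (forall x y, adj H (f x) (f y) = adj G x y) ->
  graph_iso (delete_vertex G v) (delete_vertex H (f v)).
Proof.
move=> [g fK gK] fE; apply/graph_isoP.
have fP (x : {x | x != v}) : f (val x) != f v.
  by rewrite (can_eq fK) (valP x).
have gP (y : {y | y != f v}) : g (val y) != v.
  by rewrite -(can_eq fK) gK (valP y).
exists (fun x => exist (fun y => y != f v) (f (val x)) (fP x)); split.
  exists (fun y => exist (fun x => x != v) (g (val y)) (gP y)) => x;
    by apply: val_inj; rewrite /= ?fK ?gK.
by move=> x y; rewrite !adj_graph_of !fE -!val_eqE /= (can_eq fK).
Qed.

Section EnergyInvariance.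
Variable R : rcfType.

Lemma energy_iso (T U : finType) (G : sgraph T) (H : sgraph U) :
  graph_iso G H -> energy R G = energy R H.
Proof.
move=> /graph_isoP[f [f_bij fE]]; rewrite /energy /eigenvalues.
suff -> : char_poly (adjacency_matrix R[i] G) =
          char_poly (adjacency_matrix R[i] H) by [].
apply: (@char_poly_reindex _ _ _ (fun i => enum_rank (f (enum_val i)))).
- exact: bij_eq_card f_bij.
- move=> i j /enum_rank_inj/(bij_inj f_bij); exact: enum_val_inj.
- by move=> i j; rewrite !mxE !enum_rankK fE.
Qed.

Lemma local_energy_iso (T U : finType) (G : sgraph T) (H : sgraph U) :
  graph_iso G H -> local_energy R G = local_energy R H.
Proof.
move=> GH; have /graph_isoP[f [f_bij fE]] := GH.
rewrite /local_energy (reindex f) /=; last exact: onW_bij.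
apply: eq_bigr => v _; rewrite /local_energy_at (energy_iso GH).
by congr (_ - _); apply: energy_iso; apply: delete_vertex_iso.
Qed.

(** Unique factorization over the complex numbers identifies the eigenvalues
    with the given real roots, whose moduli are absolute values. *)
Lemma energy_spectrum (T : finType) (G : sgraph T) (t : seq R) :
  char_poly (adjacency_matrix R G) = \prod_(x <- t) ('X - x%:P) ->
  energy R G = \sum_(x <- t) `|x|.
Proof.
move=> Gt; rewrite /energy /eigenvalues.
case: closed_field_poly_normal => s /=.
rewrite (monicP (char_poly_monic _)) scale1r.
have -> : adjacency_matrix R[i] G =
          map_mx (real_complex R) (adjacency_matrix R G).
  by apply/matrixP => i j; rewrite !mxE rmorph_nat.
rewrite -map_char_poly Gt rmorph_prod /=.
under eq_bigr => x _ do rewrite rmorphB /= map_polyX map_polyC /=.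
rewrite -(big_map (real_complex R) xpredT (fun z => 'X - z%:P)).
move/esym/prod_XsubC_eq => st; rewrite (perm_big _ st) big_map.
apply: eq_bigr => x _ /=.
by rewrite expr0n addr0 sqrtr_sqr.
Qed.

End EnergyInvariance.

(** * Characteristic polynomials with integer coefficients *)

(** Polynomials are lists of binary integers, constant term first and with
    trailing zeros allowed, so that they can be evaluated inside the logic. *)
Fixpoint add_coefs (s t : seq Z) : seq Z :=
  if s is a :: s' then
    if t is b :: t' then Z.add a b :: add_coefs s' t' else s
  else t.

Fixpoint mul_coefs (s t : seq Z) : seq Z :=
  if s is a :: s' then
    add_coefs (map (Z.mul a) t) (Z0 :: mul_coefs s' t)
  else [::].

Definition opp_coefs (s : seq Z) : seq Z := map Z.opp s.

Definition eq_coefs (s t : seq Z) : bool :=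
  all (Z.eqb Z0) (add_coefs s (opp_coefs t)).

(** Laplace expansion along the first row.  The minors at zero entries are
    skipped, which is what keeps the expansion cheap on sparse graphs. *)
Fixpoint det_coefs (n : nat) (a : nat -> nat -> seq Z) : seq Z :=
  if n is n'.+1 then
    foldr add_coefs [::]
      [seq if a 0 j is [::] then [::] else
           mul_coefs (if odd j then opp_coefs (a 0 j) else a 0 j)
                     (det_coefs n' (fun i k => a i.+1 (bump j k)))
      | j <- iota 0 n]
  else [:: Zpos xH].

Definition char_entry (e : rel nat) (i j : nat) : seq Z :=
  if i == j then [:: Z0; Zpos xH]
  else if adjacent e i j then [:: Zneg xH] else [::].

Definition char_coefs (n : nat) (e : rel nat) : seq Z :=
  det_coefs n (tabulate [::] n (char_entry e)).

Definition sumZ (T : Type) (w : T -> Z) (s : seq T) : Z :=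
  foldr (fun x => Z.add (w x)) Z0 s.

Section IntegerPolynomials.
Variable R : rcfType.

Definition ofZ (z : Z) : R := (int_of_Z z)%:~R.

Lemma ofZD a b : ofZ (Z.add a b) = ofZ a + ofZ b.
Proof. by rewrite /ofZ -intrD -rmorphD. Qed.

Lemma ofZM a b : ofZ (Z.mul a b) = ofZ a * ofZ b.
Proof. by rewrite /ofZ -intrM -rmorphM. Qed.

Lemma ofZN a : ofZ (Z.opp a) = - ofZ a.
Proof. by rewrite /ofZ -intrN -rmorphN. Qed.

Lemma ofZB a b : ofZ (Z.sub a b) = ofZ a - ofZ b.
Proof. by rewrite ofZD ofZN. Qed.

Lemma ofZ0 : ofZ Z0 = 0. Proof. by []. Qed.

Lemma ofZ1 : ofZ (Zpos xH) = 1. Proof. by []. Qed.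

Lemma ofZX a k : ofZ (Z.pow a (Z.of_nat k)) = ofZ a ^+ k.
Proof.
elim: k => [|k IHk]; first by rewrite expr0.
rewrite Nat2Z.inj_succ Z.pow_succ_r; last exact: Nat2Z.is_nonneg.
by rewrite ofZM IHk exprS.
Qed.

Lemma ofZ_nat k : ofZ (Z.of_nat k) = k%:R.
Proof.
by elim: k => // k IHk; rewrite Nat2Z.inj_succ ofZD IHk ofZ1 -addn1 natrD.
Qed.

Lemma ofZ_sum (w : nat -> Z) n :
  ofZ (sumZ w (iota 0 n)) = \sum_(v < n) ofZ (w v).
Proof.
rewrite -(big_mkord xpredT (fun v => ofZ (w v))) /index_iota subn0.
elim: (iota 0 n) => [|v s IHs]; first by rewrite big_nil.
by rewrite big_cons /= ofZD IHs.
Qed.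

Lemma ofZ_ge0 a : Z.leb Z0 a -> 0 <= ofZ a.
Proof. by case: a => // p _; rewrite /ofZ ler0z. Qed.

Lemma ofZ_le a b : Z.leb a b -> ofZ a <= ofZ b.
Proof.
move=> leab; rewrite -subr_ge0 -ofZB; apply: ofZ_ge0.
by move: leab => /Z.leb_le leab; apply/Z.leb_le/Z.le_0_sub.
Qed.

Lemma ofZ_lt0 a : Z.ltb a Z0 -> ofZ a < 0.
Proof. by case: a => // p _; rewrite /ofZ ltrz0. Qed.

Lemma ler_ofZ a b : (ofZ a <= ofZ b) = Z.leb a b.
Proof.
apply/idP/idP => [|/ofZ_le //]; apply: contraTT => /Z.leb_spec0 nab.
rewrite -ltNge -subr_lt0 -ofZB; apply/ofZ_lt0/Z.ltb_lt/Z.lt_sub_0.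
by apply/Z.nle_gt.
Qed.

Lemma ofZ_abs a : ofZ (Z.abs a) = `|ofZ a|.
Proof.
case: a => [|p|p]; first by rewrite normr0.
  by rewrite ger0_norm //; apply: ofZ_ge0.
rewrite -[Z.abs _]/(Z.opp (Zneg p)) ofZN ler0_norm //.
by apply/ltW/ofZ_lt0.
Qed.

Definition to_poly (s : seq Z) : {poly R} := Poly (map ofZ s).

Lemma to_poly_cons a s : to_poly (a :: s) = to_poly s * 'X + (ofZ a)%:P.
Proof. by rewrite /to_poly /= cons_poly_def. Qed.

Lemma to_poly0 : to_poly [::] = 0. Proof. by []. Qed.

Lemma to_poly1 : to_poly [:: Zpos xH] = 1.
Proof. by rewrite to_poly_cons to_poly0 mul0r add0r. Qed.

Lemma to_polyD s t : to_poly (add_coefs s t) = to_poly s + to_poly t.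
Proof.
elim: s t => [|a s IHs] [|b t] /=; rewrite ?to_poly0 ?add0r ?addr0 //.
by rewrite !to_poly_cons IHs ofZD polyCD mulrDl addrACA.
Qed.

Lemma to_polyZ a s : to_poly (map (Z.mul a) s) = (ofZ a)%:P * to_poly s.
Proof.
elim: s => [|b s IHs] /=; first by rewrite to_poly0 mulr0.
by rewrite !to_poly_cons IHs ofZM polyCM mulrDr mulrA.
Qed.

Lemma to_polyM s t : to_poly (mul_coefs s t) = to_poly s * to_poly t.
Proof.
elim: s => [|a s IHs]; first by rewrite to_poly0 mul0r.
rewrite /= to_polyD to_polyZ !to_poly_cons IHs ofZ0 addr0 mulrDl addrC.
by congr (_ + _); rewrite mulrAC.
Qed.

Lemma to_polyN s : to_poly (opp_coefs s) = - to_poly s.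
Proof.
elim: s => [|a s IHs] /=; first by rewrite to_poly0 oppr0.
by rewrite !to_poly_cons IHs ofZN polyCN mulNr opprD.
Qed.

Lemma to_poly_eq s t : eq_coefs s t -> to_poly s = to_poly t.
Proof.
move=> st; apply/eqP; rewrite -subr_eq0 -to_polyN -to_polyD; apply/eqP.
move: st; rewrite /eq_coefs; elim: (add_coefs _ _) => //= -[|//|//] u IHu /IHu.
by rewrite to_poly_cons => ->; rewrite mul0r add0r.
Qed.

Lemma to_poly_det n a :
  to_poly (det_coefs n a) = \det (\matrix_(i < n, j < n) to_poly (a i j)).
Proof.
elim: n a => [|n IHn] a; first by rewrite det_mx00 to_poly1.
rewrite (expand_det_row _ ord0).
transitivity (\sum_(j <- iota 0 n.+1) (to_poly (a 0%N j) * ((-1) ^+ j *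
    \det (\matrix_(i < n, k < n) to_poly (a i.+1 (bump j k)))))).
  rewrite [det_coefs _ _]/(foldr _ _ _); elim: (iota 0 _) => [|j s IHs] /=.
    by rewrite big_nil.
  rewrite big_cons to_polyD IHs; congr (_ + _).
  case a0j: (a 0%N j) => [|c q]; first by rewrite to_poly0 mul0r.
  rewrite to_polyM IHn mulrA -signr_odd; congr (_ * _); case: odd.
    by rewrite to_polyN expr1 mulrN1.
  by rewrite expr0 mulr1.
rewrite -[iota 0 n.+1]/(index_iota 0 n.+1) big_mkord; apply: eq_bigr => j _.
rewrite mxE /cofactor add0n; congr (_ * (_ * \det _)).
by apply/matrixP => i k; rewrite !mxE.
Qed.

Lemma to_poly_char n e :
  to_poly (char_coefs n e) = char_poly (adjacency_matrix R (ngraph n e)).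
Proof.
rewrite (@char_poly_reindex _ _ n enum_val _
           (\matrix_(i, j) (adjacent e i j)%:R)).
- rewrite to_poly_det; congr (\det _); apply/matrixP => i j.
  rewrite !mxE tabulateE // /char_entry.
  rewrite -val_eqE /=; case: eqP => [->|_].
    rewrite /adjacent eqxx subr0 2!to_poly_cons to_poly0 ofZ0 ofZ1.
    by rewrite mul0r add0r mul1r addr0.
  rewrite sub0r; case: adjacent; last by rewrite oppr0.
  by rewrite to_poly_cons to_poly0 mul0r add0r (ofZN (Zpos xH)) polyCN.
- by rewrite card_ord.
- exact: enum_val_inj.
- by move=> i j; rewrite !mxE adj_ngraph.
Qed.

Definition spectrum_of (q : seq Z) (t : seq R) : Prop :=
  to_poly q = \prod_(x <- t) ('X - x%:P).

Lemma spectrum_ofM q q' t t' :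
  spectrum_of q t -> spectrum_of q' t' -> spectrum_of (mul_coefs q q') (t ++ t').
Proof. by rewrite /spectrum_of to_polyM big_cat => -> ->. Qed.

(** A characteristic polynomial has degree [n], so the number of its roots
    bounds the accumulated error by [n] units. *)
Lemma size_spectrum n e t :
  spectrum_of (char_coefs n e) t -> size t = n.
Proof.
rewrite /spectrum_of to_poly_char => /(congr1 (fun p : {poly R} => size p)).
by rewrite size_char_poly card_ord size_prod_XsubC => -[].
Qed.

End IntegerPolynomials.

(** * Certified enclosures of energies *)

(** A monic polynomial together with an increasing list of integers, each [r] of
    which stands for a root in the half-open interval from r / precision to
    (r + 1) / precision. *)
Definition factor : Type := seq Z * seq Z.

Definition precision : Z := Z.pow 10 8.

(** Up to the positive factor precision^deg(q), the value of [q] at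
    x / precision; it is an integer, which makes its sign computable. *)
Fixpoint scaled_horner (q : seq Z) (x : Z) : Z :=
  if q is a :: q' then
    Z.add (Z.mul a (Z.pow precision (Z.of_nat (size q'))))
          (Z.mul x (scaled_horner q' x))
  else Z0.

(** The first alternative admits exact roots, such as integers, at the left end
    of the interval. *)
Definition isolates (q : seq Z) (r : Z) : bool :=
  let u := scaled_horner q r in
  Z.eqb u Z0 || Z.ltb (Z.mul u (scaled_horner q (Z.succ r))) Z0.

Definition certified (f : factor) : bool :=
  [&& Z.eqb (last Z0 f.1) (Zpos xH), size f.2 == (size f.1).-1,
      sorted Z.ltb f.2 & all (isolates f.1) f.2].

Local Open Scope Z_scope.

(** The irreducible factors of the characteristic polynomials of the graphs of
    order 5 and 6. *)
Definition factor_table : seq factor :=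
  [::
     ([:: -5; 1], [:: 500000000]);
     ([:: -4; 1], [:: 400000000]);
     ([:: -3; 1], [:: 300000000]);
     ([:: -2; 1], [:: 200000000]);
     ([:: -1; 1], [:: 100000000]);
     ([:: 0; 1], [:: 0]);
     ([:: 1; 1], [:: -100000000]);
     ([:: 2; 1], [:: -200000000]);
     ([:: 3; 1], [:: -300000000]);
     ([:: -9; -2; 1], [:: -216227767; 416227766]);
     ([:: -8; -3; 1], [:: -170156212; 470156211]);
     ([:: -8; -1; 1], [:: -237228133; 337228132]);
     ([:: -8; 0; 1], [:: -282842713; 282842712]);
     ([:: -7; -2; 1], [:: -182842713; 382842712]);
     ([:: -6; -3; 1], [:: -137228133; 437228132]);
     ([:: -6; -2; 1], [:: -164575132; 364575131]);
     ([:: -6; 0; 1], [:: -244948975; 244948974]);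
     ([:: -5; -2; 1], [:: -144948975; 344948974]);
     ([:: -5; -1; 1], [:: -179128785; 279128784]);
     ([:: -5; 0; 1], [:: -223606798; 223606797]);
     ([:: -4; -2; 1], [:: -123606798; 323606797]);
     ([:: -4; -1; 1], [:: -156155282; 256155281]);
     ([:: -3; -1; 1], [:: -130277564; 230277563]);
     ([:: -3; 0; 1], [:: -173205081; 173205080]);
     ([:: -2; -3; 1], [:: -56155282; 356155281]);
     ([:: -2; -2; 1], [:: -73205081; 273205080]);
     ([:: -2; 0; 1], [:: -141421357; 141421356]);
     ([:: -2; 2; 1], [:: -273205081; 73205080]);
     ([:: -1; -2; 1], [:: -41421357; 241421356]);
     ([:: -1; -1; 1], [:: -61803399; 161803398]);
     ([:: -1; 1; 1], [:: -161803399; 61803398]);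
     ([:: -1; 2; 1], [:: -241421357; 41421356]);
     ([:: 1; -4; 1], [:: 26794919; 373205080]);
     ([:: -12; -11; 0; 1], [:: -248361163; -128282387; 376643548]);
     ([:: -4; -9; -1; 1], [:: -223072543; -48285924; 371358466]);
     ([:: -4; -7; 0; 1], [:: -229240159; -60270494; 289510651]);
     ([:: -3; -8; -2; 1], [:: -168739957; -43162712; 411902667]);
     ([:: -3; -7; -1; 1], [:: -187740375; -47645204; 335385578]);
     ([:: -3; -6; -1; 1], [:: -158836400; -59357935; 318194333]);
     ([:: -2; -5; -1; 1], [:: -147283391; -46259843; 293543233]);
     ([:: -2; -4; 0; 1], [:: -167513088; -53918888; 221431974]);
     ([:: -1; -4; 0; 1], [:: -186080586; -25410169; 211490754]);
     ([:: -1; -2; 1; 1], [:: -180193774; -44504187; 124697960]);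
     ([:: -1; -1; 2; 1], [:: -224697961; -55495814; 80193773]);
     ([:: 1; -6; -2; 1], [:: -175153208; 15891732; 359261474]);
     ([:: 1; -5; -2; 1], [:: -157577348; 18728372; 338848974]);
     ([:: 1; -5; -1; 1], [:: -190321193; 19393656; 270927535]);
     ([:: 1; -4; -2; 1], [:: -139138239; 22713444; 316424793]);
     ([:: 1; -3; -1; 1], [:: -148119431; 31110781; 217008648]);
     ([:: 1; -2; -1; 1], [:: -124697961; 44504186; 180193773]);
     ([:: 1; -1; -2; 1], [:: -80193774; 55495813; 224697960]);
     ([:: 2; -6; -1; 1], [:: -217740969; 32163717; 285577250]);
     ([:: 2; -5; -2; 1], [:: -168133065; 35792636; 332340427]);
     ([:: 2; -4; -3; 1], [:: -129240159; 39729506; 389510651]);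
     ([:: 2; -4; -2; 1], [:: -151413693; 42800673; 308613019]);
     ([:: 2; -4; -1; 1], [:: -181360651; 47068341; 234292308]);
     ([:: 2; -3; -2; 1], [:: -134292309; 52931658; 281360650]);
     ([:: 2; -2; -2; 1], [:: -117008649; 68889218; 248119430]);
     ([:: 2; -1; -3; 1], [:: -86080586; 74589831; 311490754]);
     ([:: 3; -9; -1; 1], [:: -271774112; 32539677; 339234434]);
     ([:: 3; -7; -3; 1], [:: -180354250; 37566362; 442787887]);
     ([:: 3; -5; -3; 1], [:: -153407020; 48269595; 405137424]);
     ([:: 3; -5; -1; 1], [:: -208613020; 57199326; 251413692]);
     ([:: 4; -8; -2; 1], [:: -227945232; 45936294; 382008937]);
     ([:: 4; -8; -1; 1], [:: -262619807; 48486195; 314133611]);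
     ([:: 4; -7; -2; 1], [:: -214133612; 51513804; 362619806]);
     ([:: 4; -6; -3; 1], [:: -174656825; 54509590; 420147233]);
     ([:: 4; -5; -2; 1], [:: -185577251; 67836282; 317740968]);
     ([:: 4; -5; -1; 1], [:: -216424794; 77286555; 239138238]);
     ([:: 4; -4; -3; 1], [:: -148928858; 71083145; 377845711]);
     ([:: 4; -4; -2; 1], [:: -170927536; 80606343; 290321192]);
     ([:: 6; -4; -2; 1], [:: -186619827; 121075588; 265544238]);
     ([:: 7; -3; -3; 1], [:: -160167914; 133987688; 326180224]);
     ([:: -1; 6; -3; -2; 1], [:: -177462290; 18588534; 136040933; 222832821]);
     ([:: 1; -8; -8; 0; 1], [:: -180852975; -152660229; 11238871; 322274330]);
     ([:: 1; -2; -5; 0; 1], [:: -192022087; -75102415; 29136689; 237987812]);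
     ([:: 1; -1; -6; -1; 1], [:: -182405106; -54823027; 32854339; 304373792]);
     ([:: 1; 0; -4; 0; 1], [:: -193185166; -51763810; 51763809; 193185165]);
     ([:: 1; 3; -6; -1; 1], [:: -222000780; -23136083; 71028664; 274108198]);
     ([:: 2; -4; -6; 0; 1], [:: -174911755; -127133038; 33490398; 268554393]);
     ([:: 2; 0; -5; 0; 1], [:: -213577921; -66215345; 66215344; 213577920]);
     ([:: 2; 0; -4; 0; 1], [:: -184775907; -76536687; 76536686; 184775906]);
     ([:: 2; 1; -5; -1; 1], [:: -177571286; -58921575; 72374212; 264118647]);
     ([:: 2; 2; -5; -2; 1], [:: -154078454; -51248598; 77187627; 328139423]);
     ([:: 3; -6; -8; 0; 1], [:: -212346728; -132283400; 34429227; 310200899]);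
     ([:: 3; 0; -7; 0; 1], [:: -255761242; -67721396; 67721395; 255761241]);
     ([:: 3; 0; -5; 0; 1], [:: -207431330; -83499962; 83499961; 207431329]);
     ([:: 3; 2; -7; -2; 1], [:: -186530707; -57844086; 75344147; 369030644]);
     ([:: 3; 4; -5; -2; 1], [:: -170446782; -50892330; 111688389; 309650721]);
     ([:: 4; -8; -10; 0; 1], [:: -247148122; -133871187; 34932576; 346086732]);
     ([:: 4; -7; -11; -1; 1],
      [:: -218477087; -124463644; 36162082; 406778647]);
     ([:: 4; -5; -9; -1; 1], [:: -176696279; -138424123; 44075165; 371045236]);
     ([:: 4; 0; -7; 0; 1], [:: -252433780; -79228700; 79228699; 252433779]);
     ([:: 4; 0; -6; 0; 1], [:: -228824562; -87403205; 87403204; 228824561]);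
     ([:: 4; 1; -7; -1; 1], [:: -211291064; -75624353; 82135485; 304779930]);
     ([:: 4; 2; -8; -1; 1], [:: -239620570; -62720374; 83465288; 318875654]);
     ([:: 4; 2; -6; -2; 1], [:: -158180721; -79888014; 91275496; 346793236]);
     ([:: 4; 2; -5; -1; 1], [:: -175659826; -82024926; 113856426; 243828323]);
     ([:: 4; 3; -5; -1; 1], [:: -189121985; -70462437; 131743060; 227841360]);
     ([:: 4; 4; -6; -1; 1], [:: -219116858; -57671252; 126437659; 250350449]);
     ([:: 4; 6; -5; -2; 1], [:: -184223568; -50694192; 150694191; 284223567]);
     ([:: 5; -2; -6; 0; 1], [:: -187227622; -137032595; 79681511; 244578704]);
     ([:: 5; 0; -5; 0; 1], [:: -190211304; -117557051; 117557050; 190211303]);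
     ([:: 6; -4; -8; 0; 1], [:: -224034211; -136837087; 66483383; 294387913]);
     ([:: 6; -2; -8; -1; 1], [:: -179845710; -132791200; 74243837; 338393071]);
     ([:: 6; 0; -6; 0; 1], [:: -217532775; -112603251; 112603250; 217532774]);
     ([:: 7; -4; -9; 0; 1], [:: -250862209; -128551860; 70197507; 309216561]);
     ([:: 7; -2; -8; 0; 1], [:: -245413943; -119549112; 85319313; 279643740]);
     ([:: 8; 1; -7; -1; 1], [:: -182082228; -128586469; 115927432; 294741264]);
     ([:: -1; 3; 3; -7; -1; 1],
      [:: -231165705; -65695377; 30877747; 72716557; 293266775]);
     ([:: -1; 5; -2; -8; -1; 1],
      [:: -186190973; -128269615; 25119716; 48972681; 340368188]);
     ([:: -1; 7; -1; -9; -1; 1],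
      [:: -219068823; -118762804; 15054375; 72991892; 349785358]);
     ([:: -1; 7; 2; -6; -1; 1],
      [:: -167828036; -131977476; 13966580; 122973801; 262865128]);
     ([:: -1; 9; 2; -8; -1; 1],
      [:: -217865095; -117357095; 10962585; 115579741; 308679862]);
     ([:: 3; 7; -6; -10; -1; 1],
      [:: -178315014; -147581474; -37914564; 77915907; 385895143]);
     ([:: 4; 5; -10; -10; 0; 1],
      [:: -217693486; -147816004; -52840921; 66944265; 351406143]);
     ([:: 4; 5; -8; -9; 0; 1],
      [:: -213924777; -129273014; -59751758; 73470403; 329479142]);
     ([:: 4; 7; -4; -7; 0; 1],
      [:: -185133463; -135036442; -55997008; 105608239; 270558672]);
     ([:: 4; 10; -3; -9; -1; 1],
      [:: -169896859; -151105279; -40714540; 108274828; 353441848]);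
     ([:: 6; 8; -6; -8; 0; 1],
      [:: -177960787; -153708297; -70620052; 104195475; 298093658]);
     ([:: -1; 0; 7; -2; -7; 0; 1],
      [:: -214198710; -130529766; -38475266; 46685622; 76610878; 259907239]);
     ([:: -1; 2; 6; -4; -7; 0; 1],
      [:: -189420347; -132926463; -60927972; 30635819; 77267479; 275371482]);
     ([:: -1; 2; 7; -2; -6; 0; 1],
      [:: -173967731; -137378968; -59452323; 27420501; 109958465; 233420053]);
     ([:: -1; 2; 8; -6; -9; 0; 1],
      [:: -220516776; -150578791; -46629957; 27984825; 72821236; 316919459]);
     ([:: -1; 2; 8; -2; -7; 0; 1],
      [:: -213639304; -120607577; -54063225; 26114370; 108247361; 253948373]);
     ([:: -1; 4; 7; -6; -8; 0; 1],
      [:: -185634339; -147798441; -72482438; 19669049; 84813601; 301432565]);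
     ([:: -1; 4; 9; -4; -8; 0; 1],
      [:: -215843760; -127184880; -66106086; 18300709; 105542279; 285291736])].

Local Close Scope Z_scope.

Lemma factor_table_certified : all certified factor_table.
Proof. by vm_cast_no_check (erefl true). Qed.

(** Division by a monic polynomial [q]; the remainder keeps the fixed length
    deg(q), so that the leading coefficient to cancel is always the last one. *)
Fixpoint div_coefs (p q : seq Z) : seq Z * seq Z :=
  if p is c :: p' then
    let: (u, r) := div_coefs p' q in
    let r' := c :: r in
    let t := last Z0 r' in
    (t :: u, take (size q).-1 (add_coefs r' (opp_coefs (map (Z.mul t) q))))
  else ([::], nseq (size q).-1 Z0).

(** Trial division by the entries of [tab], each as often as possible.  The fuel
    [n] must exceed the number of factors, since one more unit is spent on
    leaving the last entry. *)
Fixpoint factorize (tab : seq factor) (n : nat) (p : seq Z) : seq factor :=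
  if tab is f :: tab' then
    (fix repeat (n : nat) (p : seq Z) : seq factor :=
       if n is n'.+1 then
         let: (u, r) := div_coefs p f.1 in
         if all (Z.eqb Z0) r then f :: repeat n' u else factorize tab' n p
       else [::]) n p
  else [::].

Lemma factorize_sub tab n p : {subset factorize tab n p <= tab}.
Proof.
elim: tab n p => //= f tab IHtab n p g.
elim: n p => //= n IHn p; case: (div_coefs _ _) => u r; case: ifP => _.
  by rewrite !inE => /predU1P[->|/IHn]; rewrite ?eqxx.
by move=> /IHtab; rewrite inE => ->; rewrite orbT.
Qed.

(** The degree [n] bounds the number of factors, whence the fuel. *)
Definition char_factors n e := factorize factor_table n.+1 (char_coefs n e).

(** The factors come from a search, so their product is compared with the
    characteristic polynomial. *)
Definition factored (n : nat) (e : rel nat) : bool :=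
  eq_coefs (char_coefs n e)
           (foldr mul_coefs [:: Zpos xH] (map fst (char_factors n e))).

Definition magnitude (fs : seq factor) : Z :=
  sumZ (fun f => sumZ Z.abs f.2) fs.

Section Enclosures.
Variable R : rcfType.
Local Notation ofZ := (ofZ R).
Local Notation to_poly := (to_poly R).

(** Locked so that unification never unfolds the unary image of 10^8. *)
Definition scale : R := locked (ofZ precision).
Local Notation N := scale.

Lemma scaleE : ofZ precision = scale.
Proof. by rewrite /scale -lock. Qed.

Lemma scale_gt0 : 0 < N.
Proof. by rewrite -scaleE -oppr_lt0 -ofZN; apply: ofZ_lt0. Qed.

Lemma scaled_hornerE q x :
  ofZ (scaled_horner q x) * N = N ^+ size q * (to_poly q).[ofZ x / N].
Proof.
have N0 : N != 0 by rewrite gt_eqF ?scale_gt0.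
have : ofZ x = N * (ofZ x / N) by rewrite mulrC divfK.
move: (ofZ x / N) => y xE.
elim: q => [|a q IHq]; first by rewrite /to_poly /= horner0 mulr0 mul0r.
rewrite to_poly_cons !hornerE /= ofZD !ofZM ofZX scaleE.
transitivity (ofZ a * N ^+ size q * N + ofZ x * (ofZ (scaled_horner q x) * N)).
  by rewrite mulrDl mulrA.
by rewrite IHq xE exprS; ring.
Qed.

Lemma isolated_root q r : isolates q r ->
  exists x, [&& root (to_poly q) x, ofZ r <= N * x & N * x < ofZ r + 1].
Proof.
have N0 := scale_gt0; have N0' : N != 0 by rewrite gt_eqF.
have hN y : N * (ofZ y / N) = ofZ y by rewrite mulrC divfK.
case/orP => [/Z.eqb_eq q0|qlt].
  exists (ofZ r / N); rewrite hN lexx ltrDl ltr01 !andbT.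
  have := scaled_hornerE q r; rewrite q0 mul0r => /esym/eqP.
  by rewrite mulf_eq0 expf_eq0 (negbTE N0') andbF.
have lt_r : ofZ r / N <= ofZ (Z.succ r) / N.
  by rewrite ler_pM2r ?invr_gt0 // ofZD lerDl ler01.
have [|x xr rx] := poly_ivtoo (p := to_poly q) lt_r.
  have Nq : 0 < N ^+ size q * N ^+ size q by rewrite mulr_gt0 // exprn_gt0.
  rewrite -(pmulr_rlt0 _ Nq) mulrACA -!scaled_hornerE mulrACA -ofZM.
  by rewrite pmulr_llt0 ?mulr_gt0 //; apply: ofZ_lt0.
exists x; rewrite rx /=; move: xr; rewrite in_itv /=.
by rewrite ltr_pdivrMr // ltr_pdivlMr // mulrC ofZD => /andP[/ltW -> /=].
Qed.

(** Distinct integers give disjoint half-open intervals, so the roots found in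
    them are distinct; there are as many as the degree, hence these are all
    the roots, each one simple. *)
Lemma certified_spectrum f : certified f -> exists t,
  spectrum_of f.1 t /\
  `|N * (\sum_(x <- t) `|x|) - ofZ (sumZ Z.abs f.2)| <= (size t)%:R.
Proof.
case: f => q rs; rewrite /certified /= => /and4P[/Z.eqb_eq lq /eqP sz srt iso].
have N0 := scale_gt0.
have [g gP] : exists g : Z -> R, forall r, r \in rs ->
    [&& root (to_poly q) (g r), ofZ r <= N * g r & N * g r < ofZ r + 1].
  suff /choice[g gP] : forall r, exists x, r \in rs ->
      [&& root (to_poly q) x, ofZ r <= N * x & N * x < ofZ r + 1] by exists g.
  move=> r; have [rrs|_] := boolP (r \in rs); last by exists 0.
  by have [x] := isolated_root (allP iso _ rrs); exists x.
have Urs : uniq rs.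
  apply: (sorted_uniq (leT := Z.ltb)) srt.
    by move=> y x z /Z.ltb_lt xy /Z.ltb_lt yz; apply/Z.ltb_lt/(Z.lt_trans _ y).
  by move=> x; rewrite Z.ltb_irrefl.
have g_lt r s : r \in rs -> s \in rs -> Z.lt r s -> g r < g s.
  move=> /gP/and3P[_ _ r1] /gP/and3P[_ s1 _] /Z.le_succ_l/Z.leb_le/(ofZ_le R).
  rewrite ofZD ofZ1 => rs1; rewrite -(ltr_pM2l N0).
  exact: lt_le_trans r1 (le_trans rs1 s1).
have g_inj : {in rs &, injective g}.
  move=> r s rrs srs grs; case: (Z.lt_trichotomy r s) => [lt|[//|lt]].
    by have := g_lt _ _ rrs srs lt; rewrite grs ltxx.
  by have := g_lt _ _ srs rrs lt; rewrite grs ltxx.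
exists (map g rs); split.
  have mq : last 1 (map ofZ q) = 1.
    by case: (q) lq => //= a q' lq'; rewrite last_map lq'.
  have qE : to_poly q = map ofZ q :> seq R.
    by rewrite (PolyK (c := 1)) // mq oner_neq0.
  have q_gt0 : (0 < size q)%N by case: (q) lq.
  rewrite /spectrum_of [LHS](@all_roots_prod_XsubC _ _ (map g rs)).
  - rewrite lead_coefE qE nth_last.
    by case: (q) q_gt0 mq => //= a q' _ ->; rewrite scale1r.
  - by rewrite qE !size_map sz prednK.
  - by apply/allP => x /mapP[r rrs ->]; case/and3P: (gP r rrs).
  - by rewrite uniq_rootsE map_inj_in_uniq.
rewrite big_map size_map; elim: (rs) gP => [|r s IHs] gP.
  by rewrite big_nil mulr0 subr0 normr0.
rewrite big_cons /= ofZD ofZ_abs mulrDr opprD addrACA.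
rewrite (le_trans (ler_normD _ _)) // -add1n natrD lerD //; last first.
  by apply: IHs => r' r's; apply: gP; rewrite inE r's orbT.
have /and3P[_ r1 r2] := gP r (mem_head _ _).
rewrite -{1}(gtr0_norm N0) -normrM (le_trans (ler_dist_dist _ _)) //.
by rewrite ger0_norm ?subr_ge0 // lerBlDl; apply: ltW.
Qed.

Lemma energy_enclosure n e : factored n e ->
  `|N * energy R (ngraph n e) - ofZ (magnitude (char_factors n e))| <= n%:R.
Proof.
rewrite /factored => /(to_poly_eq R) ch.
suff [t [tch tmag]] : exists t, spectrum_of (char_coefs n e) t /\
    `|N * (\sum_(x <- t) `|x|) - ofZ (magnitude (char_factors n e))|
      <= (size t)%:R.
  rewrite (energy_spectrum (t := t)); last by rewrite -to_poly_char.
  by move: tmag; rewrite (size_spectrum tch).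
rewrite /spectrum_of ch.
have : {in char_factors n e, forall f, certified f}.
  by move=> f /factorize_sub; apply: (allP factor_table_certified).
elim: (char_factors n e) => [|f fs IHfs] fP.
  by exists [::]; rewrite to_poly1 !big_nil mulr0 subr0 normr0.
have [|t [tE tmag]] := IHfs.
  by move=> g gs; apply: fP; rewrite inE gs orbT.
have [u [uE umag]] := certified_spectrum (fP f (mem_head _ _)).
exists (u ++ t); split; first exact: spectrum_ofM.
rewrite big_cat /= ofZD mulrDr opprD addrACA size_cat natrD.
by rewrite (le_trans (ler_normD _ _)) // lerD.
Qed.

End Enclosures.

(** * Exact energies in Z + Z sqrt 5 *)

(** The minimal polynomials of the golden ratio and of its opposite, the only
    irrational factors that C_5 and P_4 give rise to. *)
Definition golden (q : seq Z) : bool :=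
  q \in [:: [:: Zneg xH; Zpos xH; Zpos xH]; [:: Zneg xH; Zneg xH; Zpos xH]].

Definition is_surd (q : seq Z) : bool :=
  (size q == 2) && Z.eqb (last Z0 q) (Zpos xH) || golden q.

(** With [surd_part], the sum of the absolute values of the roots of [q]: |c|
    for X + c, and sqrt 5 for either golden polynomial, whose roots are the
    golden ratio and its negated inverse, up to a common sign. *)
Definition rational_part (q : seq Z) : Z :=
  if q is [:: c; _] then Z.abs c else Z0.

Definition surd_part (q : seq Z) : Z :=
  if size q == 3 then Zpos xH else Z0.

Definition surd_factored (n : nat) (e : rel nat) : bool :=
  factored n e && all is_surd (map fst (char_factors n e)).

Definition rational_energy n e :=
  sumZ (fun f : factor => rational_part f.1) (char_factors n e).

Definition surd_energy n e :=
  sumZ (fun f : factor => surd_part f.1) (char_factors n e).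

Section ExactEnergies.
Variable R : rcfType.
Local Notation ofZ := (ofZ R).

Lemma surd_spectrum q : is_surd q -> exists2 t,
  spectrum_of q t &
  \sum_(x <- t) `|x| = ofZ (rational_part q) + ofZ (surd_part q) * Num.sqrt 5.
Proof.
case/orP=> [|qg].
  case: q => [//|a [//|b [|//]]] /= /Z.eqb_eq ->; exists [:: - ofZ a].
    rewrite /spectrum_of !to_poly_cons big_seq1 to_poly0.
    by rewrite mul0r add0r mul1r polyCN opprK.
  by rewrite big_seq1 normrN /= ofZ_abs ofZ0 mul0r addr0.
have [b [-> b2]] :
    exists b, q = [:: Zneg xH; b; Zpos xH] /\ (ofZ b = 1 \/ ofZ b = -1).
  move: qg; rewrite /golden !inE => /orP[]/eqP ->.
    by exists (Zpos xH); split=> //; left.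
  by exists (Zneg xH); split=> //; right.
pose s : R := Num.sqrt 5; have s2 : s ^+ 2 = 5 by rewrite sqr_sqrtr ?ler0n.
have s1 : 1 < s by rewrite -[ltLHS]sqrtr1 ltr_sqrt ?ltr1n ?ltr0n.
pose x := (- ofZ b + s) / 2; pose y := (- ofZ b - s) / 2.
exists [:: x; y]; last first.
  rewrite !big_cons big_nil addr0 /= ofZ0 ofZ1 add0r mul1r /x /y -/s.
  by case: b2 => ->; rewrite ger0_norm ?ltr0_norm; lra.
rewrite /spectrum_of !to_poly_cons !big_cons big_nil to_poly0.
rewrite mul0r add0r mulr1.
have xy : ofZ (Zneg xH) = x * y.
  by rewrite (ofZN _ (Zpos xH)) ofZ1 /x /y; case: b2 => ->; field: s2.
have xDy : ofZ b = - (x + y) by rewrite /x /y; field.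
by clearbody x y; rewrite xy xDy ofZ1 polyCN polyCD polyCM; ring.
Qed.

Lemma energy_exact n e : surd_factored n e ->
  energy R (ngraph n e) =
  ofZ (rational_energy n e) + ofZ (surd_energy n e) * Num.sqrt 5.
Proof.
case/andP=> /(to_poly_eq R) ch /allP fP; rewrite /rational_energy /surd_energy.
suff [t tE <-] : exists2 t, spectrum_of (char_coefs n e) t &
    \sum_(x <- t) `|x| =
      ofZ (sumZ (fun f : factor => rational_part f.1) (char_factors n e)) +
      ofZ (sumZ (fun f : factor => surd_part f.1) (char_factors n e))
        * Num.sqrt 5.
  by apply: energy_spectrum; rewrite -to_poly_char.
rewrite /spectrum_of ch; elim: (char_factors n e) fP => [|f fs IHfs] fP.
  by exists [::]; rewrite ?to_poly1 !big_nil //= !ofZ0 mul0r addr0.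
have [|t tE tS] := IHfs.
  by move=> g gs; apply: fP; rewrite inE gs orbT.
have [u uE uS] := surd_spectrum (fP f.1 (mem_head _ _)).
exists (u ++ t); first exact: spectrum_ofM.
by rewrite big_cat /= !ofZD mulrDl uS tS addrACA.
Qed.

End ExactEnergies.

(** * Local energies *)

(** The local energy of a graph of order n + 1 is a fixed integer combination
    of its energy and those of the graphs of its deck; the same combination
    applies to the approximate, rational and surd parts of energies. *)
Definition local_sum (w : nat -> rel nat -> Z) (n : nat) (e : rel nat) : Z :=
  Z.sub (Z.mul (Z.of_nat n.+1) (w n.+1 e))
        (sumZ (fun v => w n (delete v e)) (iota 0 n.+1)).

Definition on_deck (P : nat -> rel nat -> bool) (n : nat) (e : rel nat) : bool :=
  P n.+1 e && all (fun v => P n (delete v e)) (iota 0 n.+1).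

Lemma on_deckP P n e : on_deck P n e ->
  P n.+1 e /\ forall v : 'I_n.+1, P n (delete v e).
Proof.
case/andP=> Pe /allP Pd; split=> // v; apply: Pd.
by rewrite mem_iota ltn_ord.
Qed.

Section LocalEnergies.
Variable R : rcfType.
Local Notation ofZ := (ofZ R).

Lemma local_energy_ngraph n e :
  local_energy R (ngraph n.+1 e) =
  n.+1%:R * energy R (ngraph n.+1 e)
    - \sum_(v < n.+1) energy R (ngraph n (delete v e)).
Proof.
rewrite /local_energy sumrB sumr_const card_ord mulr_natl; congr (_ - _).
by apply: eq_bigr => v _; apply/energy_iso/delete_ngraph_iso.
Qed.

Lemma local_energy_enclosure n e : on_deck factored n e ->
  `|scale R * local_energy R (ngraph n.+1 e)
     - ofZ (local_sum (fun m d => magnitude (char_factors m d)) n e)|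
    <= (n.+1 * n.+1 + n.+1 * n)%:R.
Proof.
case/on_deckP=> Pe Pd.
rewrite local_energy_ngraph /local_sum ofZB ofZM ofZ_nat ofZ_sum.
have -> (E m : R) (F w : 'I_n.+1 -> R) :
    scale R * (n.+1%:R * E - \sum_v F v) - (n.+1%:R * m - \sum_v w v) =
    n.+1%:R * (scale R * E - m) - \sum_v (scale R * F v - w v).
  by rewrite sumrB -mulr_sumr; ring.
rewrite natrD !natrM (le_trans (ler_normB _ _)) // lerD //.
  by rewrite normrM normr_nat ler_pM2l ?ltr0n // energy_enclosure.
have -> : n.+1%:R * n%:R = \sum_(v < n.+1) n%:R :> R.
  by rewrite sumr_const card_ord mulr_natl.
rewrite (le_trans (ler_norm_sum _ _ _)) //; apply: ler_sum => v _.
exact: energy_enclosure.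
Qed.

Lemma local_energy_exact n e : on_deck surd_factored n e ->
  local_energy R (ngraph n.+1 e) =
  ofZ (local_sum rational_energy n e)
    + ofZ (local_sum surd_energy n e) * Num.sqrt 5.
Proof.
case/on_deckP=> Pe Pd.
rewrite local_energy_ngraph /local_sum !ofZB !ofZM ofZ_nat.
rewrite !ofZ_sum energy_exact //.
under eq_bigr => v _ do rewrite energy_exact //.
rewrite big_split /= -mulr_suml.
have regroup (m a b c d s : R) :
    m * (a + b * s) - (c + d * s) = m * a - c + (m * b - d) * s by ring.
exact: regroup.
Qed.

End LocalEnergies.

(** * Enumeration of labelled graphs *)

Local Close Scope ring_scope.

Definition pairs (n : nat) : seq (nat * nat) :=
  [seq (i, j) | j <- iota 0 n, i <- iota 0 j].

Definition encode (n : nat) (e : rel nat) : bitseq :=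
  [seq e p.1 p.2 | p <- pairs n].

Lemma encodeP n e e' : encode n e = encode n e' ->
  forall i j, i < j < n -> e i j = e' i j.
Proof.
move=> /eq_in_map ee' i j /andP[ij jn]; apply: (ee' (i, j)).
apply/allpairsPdep; exists j, i.
by rewrite !mem_iota.
Qed.

Lemma eq_on_pairs n (a b : rel 'I_n) :
    symmetric a -> symmetric b -> (forall i, a i i = b i i) ->
    (forall i j : 'I_n, i < j -> a i j = b i j) -> a =2 b.
Proof.
move=> sa sb ab0 ab i j; case: (ltngtP i j) => [/ab //|/ab|/ord_inj ->//].
by rewrite sa sb.
Qed.

Lemma eq_ngraph n e e' :
  encode n (adjacent e) = encode n (adjacent e') -> ngraph n e = ngraph n e'.
Proof.
move=> /encodeP ee'; apply/adj_inj/eq_on_pairs => [i j|i j|i|i j ij].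
- exact: adj_sym.
- exact: adj_sym.
- by rewrite !adj_irr.
- by rewrite !adj_ngraph ee' // ij ltn_ord.
Qed.

Definition relabellings (n : nat) (e : rel nat) : seq bitseq :=
  let a := tabulate false n (adjacent e) in
  [seq encode n (fun i j => a (nth 0 s i) (nth 0 s j))
  | s <- permutations (iota 0 n)].

Lemma relabelling_iso n (G : sgraph 'I_n.+1) e :
  encode n.+1 (fun i j => adj G (inord i) (inord j)) \in relabellings n.+1 e ->
  graph_iso G (ngraph n.+1 e).
Proof.
case/mapP=> s; rewrite mem_permutations => s_iota /encodeP Gs.
have sz_s : size s = n.+1 by rewrite (perm_size s_iota) size_iota.
have s_lt i : i < n.+1 -> nth 0 s i < n.+1.
  by rewrite -{1}sz_s => /(mem_nth 0); rewrite (perm_mem s_iota) mem_iota.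
pose f (i : 'I_n.+1) : 'I_n.+1 := inord (nth 0 s i).
have fE (i : 'I_n.+1) : f i = nth 0 s i :> nat by rewrite inordK ?s_lt.
apply/graph_isoP; exists f; split.
  apply: injF_bij => i j /(congr1 val); rewrite /= !fE => /eqP.
  rewrite nth_uniq ?sz_s ?ltn_ord // => [/eqP/ord_inj //|].
  by rewrite (perm_uniq s_iota) iota_uniq.
apply: eq_on_pairs => [i j|i j|i|i j ij]; first exact: adj_sym.
- exact: adj_sym.
- by rewrite !adj_irr.
have := Gs i j; rewrite ij ltn_ord !inord_val => -> //.
by rewrite tabulateE ?s_lt // adj_ngraph !fE.
Qed.

(** Decides whether [L] contains all the bit sequences of length [k], by
    branching on the first bit; this takes time linear in the size of [L]. *)
Fixpoint covers (k : nat) (L : seq bitseq) : bool :=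
  if k is k'.+1 then
    covers k' [seq behead b | b <- L & head false b] &&
    covers k' [seq behead b | b <- L & ~~ head true b]
  else L != [::].

Lemma coversP k L b : covers k L -> all (fun c => size c == k) L ->
  size b = k -> b \in L.
Proof.
elim: k L b => [|k IHk] L b /=.
  case: L => // c L _ /andP[/nilP -> _] /size0nil ->; exact: mem_head.
have tails (P : pred bitseq) : all (fun c => size c == k.+1) L ->
    all (fun c => size c == k) [seq behead c | c <- L & P c].
  move=> /allP szL; apply/allP => _ /mapP[c + ->]; rewrite mem_filter.
  by case/andP=> _ /szL; rewrite size_behead => /eqP ->.
case/andP=> cov1 cov0 szL; case: b => // -[] b [szb].
  have /mapP[[|x c]] := IHk _ b cov1 (tails _ szL) szb.
    by rewrite mem_filter.
  by rewrite mem_filter /= => /andP[-> cL] ->.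
have /mapP[[|x c]] := IHk _ b cov0 (tails _ szL) szb.
  by rewrite mem_filter.
by rewrite mem_filter /= => /andP[/negbTE -> cL] ->.
Qed.

(** * The graphs of order 6 *)

Local Open Scope Z_scope.

(** In a pair [(c, l)], the bit of [c] at position i + j(j - 1)/2 tells whether
    i < j are adjacent, and [l] is the local energy in units of 1e-8, as it
    results from rounding the roots in [factor_table].  The nine graphs are
    K_6, K_4 + K_2, 2 K_3, 3 K_2; K_5 + K_1, K_3 + K_2 + K_1, C_5 + K_1;
    K_4 + 2 K_1, 2 K_2 + 2 K_1, with + for disjoint union. *)
Definition equienergetic_codes : seq (Z * Z) :=
  [::
    (32767, 1200000000); (16447, 1200000000); (25095, 1200000000);
    (16417, 1200000000); (1023, 1000000000); (519, 1000000000);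
    (613, 1000000000); (63, 800000000); (33, 800000000)].

(** The other 147 graphs, by increasing local energy. *)
Definition other_codes : seq (Z * Z) :=
  [::
    (0, 0); (1, 400000000); (3, 448528139); (30, 468629148); (11, 537112505);
    (222, 556669423); (7, 600000000); (75, 614359356); (3294, 634520754);
    (7672, 660612306); (1099, 683281570); (31, 683556826); (223, 770247989);
    (507, 786825723); (15, 819270014); (13, 823168950); (3295, 846737590);
    (76, 848528139); (1456, 868629148); (86, 871938191); (254, 872621397);
    (94, 874252588); (237, 883181577); (95, 886406763); (7675, 888183854);
    (77, 889445868); (1108, 897056278); (1457, 903757549); (511, 908819626);
    (87, 915432880); (16350, 916718430); (1459, 925628367); (79, 928308458);
    (3309, 929666292); (1100, 937112505); (3576, 938779914); (1109, 943813830);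
    (1118, 947467047); (1531, 954024837); (3582, 955977118); (1467, 962973666);
    (1110, 965679153); (1246, 966723944); (7673, 975047632); (3326, 975235308);
    (3310, 976691089); (1247, 976882611); (1101, 976889773); (1182, 978467866);
    (1465, 978701911); (1119, 995043221); (3578, 995878229); (7916, 995896218);
    (7679, 1007282409); (1111, 1008199384); (1103, 1015192328);
    (1183, 1021862858); (117, 1023653702); (127, 1025420345);
    (16351, 1035709348); (1140, 1048528139); (119, 1061951989);
    (255, 1064231794); (3306, 1070992335); (3308, 1079887684);
    (1460, 1083556826); (239, 1089153880); (4094, 1094091937);
    (1141, 1101192067); (1461, 1106406998); (1468, 1118457363);
    (1532, 1121434365); (3950, 1123864306); (1143, 1124517854);
    (16383, 1125273486); (1535, 1126150054); (3577, 1127464880);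
    (1151, 1133108336); (3885, 1136026850); (1463, 1139452617);
    (3583, 1141020209); (3311, 1153102014); (1469, 1158044032);
    (1471, 1158929264); (1533, 1166222852); (3327, 1171628476);
    (235, 1176597375); (8187, 1183697115); (3579, 1187928677);
    (3875, 1204061444); (3959, 1208235942); (7934, 1211164790);
    (7919, 1211996608); (1268, 1214781623); (1194, 1219270014);
    (1185, 1223168950); (1973, 1224650097); (2047, 1229574694);
    (3966, 1238383749); (1196, 1239818110); (1215, 1244843300);
    (1260, 1247031954); (3307, 1249660051); (3449, 1249663458);
    (1198, 1249857044); (1214, 1252584822); (1187, 1253299979);
    (1975, 1256661474); (1270, 1257979276); (1195, 1258419536);
    (3887, 1261621666); (3448, 1262946114); (3452, 1264699960);
    (1197, 1265799950); (1279, 1267294197); (3455, 1267912654);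
    (1199, 1271982504); (3879, 1275003205); (1278, 1275732090);
    (1271, 1280188060); (7902, 1280188720); (4095, 1281428734);
    (1983, 1281562696); (8185, 1282596272); (3453, 1284675729);
    (1191, 1286211288); (1261, 1288119055); (3949, 1290989505);
    (7917, 1292868458); (1269, 1295086192); (1263, 1296849740);
    (8191, 1297152084); (3967, 1303116588); (3903, 1309388242);
    (3451, 1313872010); (1259, 1320658541); (3951, 1324945570);
    (7935, 1332253488); (3948, 1365059668); (3947, 1379428497);
    (3958, 1402694916); (7915, 1421989344); (3441, 1423934048);
    (7903, 1424426912); (3447, 1481997570); (3443, 1516428536);
    (3440, 1521539034)].

Local Close Scope Z_scope.

Definition all_codes : seq (Z * Z) := equienergetic_codes ++ other_codes.

Definition code_rel (c : Z) : rel nat :=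
  fun i j => (i < j) && Z.testbit c (Z.of_nat (i + (j * j.-1)./2)).

Definition code_graph (x : Z * Z) : sgraph 'I_6 := ngraph 6 (code_rel x.1).

Definition approximated (x : Z * Z) : bool :=
  on_deck factored 5 (code_rel x.1) &&
  Z.eqb (local_sum (fun n e => magnitude (char_factors n e)) 5 (code_rel x.1))
        x.2.

Lemma codes_approximated : all approximated all_codes.
Proof. by vm_cast_no_check (erefl true). Qed.

Definition exact (x : Z * Z) : bool :=
  [&& on_deck surd_factored 5 (code_rel x.1),
      Z.eqb (local_sum surd_energy 5 (code_rel x.1)) Z0 &
      Z.eqb (Z.mul precision (local_sum rational_energy 5 (code_rel x.1))) x.2].

Lemma equienergetic_codes_exact : all exact equienergetic_codes.
Proof. by vm_cast_no_check (erefl true). Qed.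

(** Twice the error bound of [local_energy_enclosure] for order 6. *)
Definition tolerance : Z := Z.of_nat (2 * (6 * 6 + 6 * 5)).

Definition separated (x y : Z * Z) : bool :=
  [|| Z.ltb tolerance (Z.abs (Z.sub x.2 y.2)), x == y |
   [&& x \in equienergetic_codes, y \in equienergetic_codes & x.2 == y.2]].

(** The two closest approximations that do not belong to one class differ by
    660 units, against a tolerance of 132. *)
Lemma codes_separated : all2rel separated all_codes.
Proof. by vm_cast_no_check (erefl true). Qed.

(** The 156 * 720 relabellings contain the upper triangles of all the simple
    graphs on six labelled vertices, 15 bits each. *)
Lemma codes_cover :
  covers 15 (flatten [seq relabellings 6 (code_rel x.1) | x <- all_codes]).
Proof. by vm_cast_no_check (erefl true). Qed.

(** Within a class, the number of edges tells the graphs apart. *)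
Lemma equienergetic_codes_edges : all2rel (fun x y : Z * Z =>
    (x == y) || (x.2 != y.2) ||
    (count_edge_pairs 6 (code_rel x.1) != count_edge_pairs 6 (code_rel y.1)))
  equienergetic_codes.
Proof. by vm_cast_no_check (erefl true). Qed.

Lemma code_graph_complete (G : sgraph 'I_6) :
  exists2 x, x \in all_codes & graph_iso G (code_graph x).
Proof.
have := coversP (b := encode 6 (fun i j => adj G (inord i) (inord j)))
  codes_cover.
case/(_ _ _)/flattenP => [|//|_ /mapP[x xall ->] Gx].
  by apply/allP => _ /flattenP[_ /mapP[x _ ->] /mapP[s _ ->]]; rewrite size_map.
by exists x => //; apply: relabelling_iso.
Qed.

(** * Coincidences of local energies *)

Section Classification.
Variable R : rcfType.
Local Notation ofZ := (ofZ R).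
Local Open Scope ring_scope.

Lemma code_graph_enclosure x : x \in all_codes ->
  `|scale R * local_energy R (code_graph x) - ofZ x.2| <= (6 * 6 + 6 * 5)%:R.
Proof.
by move=> /(allP codes_approximated)/andP[ok /Z.eqb_eq <-];
  apply: local_energy_enclosure.
Qed.

Lemma code_graph_exact x : x \in equienergetic_codes ->
  scale R * local_energy R (code_graph x) = ofZ x.2.
Proof.
move=> /(allP equienergetic_codes_exact)/and3P[ok /Z.eqb_eq surd0 /Z.eqb_eq <-].
by rewrite ofZM scaleE local_energy_exact // surd0 mul0r addr0.
Qed.

Lemma local_energy_code_graph x y :
  x \in equienergetic_codes -> y \in equienergetic_codes -> x.2 = y.2 ->
  local_energy R (code_graph x) = local_energy R (code_graph y).
Proof.
move=> xe ye xy; have N0 : scale R != 0 by rewrite gt_eqF ?scale_gt0.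
apply: (mulfI N0); apply: etrans (code_graph_exact xe) _.
by rewrite xy; apply/esym/code_graph_exact.
Qed.

Lemma close_codes x y : x \in all_codes -> y \in all_codes ->
  local_energy R (code_graph x) = local_energy R (code_graph y) ->
  Z.leb (Z.abs (Z.sub x.2 y.2)) tolerance.
Proof.
move=> /code_graph_enclosure + /code_graph_enclosure + xy.
rewrite xy -(ler_ofZ R) ofZ_abs ofZB ofZ_nat natrM {xy}.
move: (_ * local_energy _ _) (ofZ _) (ofZ _) (_%:R) => u a b K.
by rewrite !ler_norml => /andP[? ?] /andP[? ?]; apply/andP; split; lra.
Qed.

Lemma same_local_energy x y :
  x \in all_codes -> y \in all_codes ->
  local_energy R (code_graph x) = local_energy R (code_graph y) ->
  x = y \/ [/\ x \in equienergetic_codes, y \in equienergetic_codes & x.2 = y.2].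
Proof.
move=> xall yall /close_codes -/(_ xall yall) near.
have := allrelP codes_separated x y xall yall.
case/or3P=> [far|/eqP ->|/and3P[xe ye /eqP xy]]; [|by left|by right].
by move: near; rewrite Z.leb_antisym far.
Qed.

Lemma equienergetic_code_graph_inj :
  {in equienergetic_codes &, forall x y,
     graph_iso (code_graph x) (code_graph y) -> x = y}.
Proof.
move=> x y xe ye xy; have := allrelP equienergetic_codes_edges x y xe ye.
rewrite -!edge_pairs_ngraph (edge_pairs_iso xy) eqxx orbF.
have zxy : ofZ x.2 = ofZ y.2.
  rewrite -(code_graph_exact xe) -(code_graph_exact ye).
  by rewrite (local_energy_iso R xy).
case/orP=> /eqP // [].
by apply: Z.le_antisymm; apply/Z.leb_le; rewrite -(ler_ofZ R) zxy lexx.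
Qed.

Definition code_class (l : Z) : {set {set sgraph 'I_6}} :=
  [set Y in
    [seq iso_class 6 (code_graph x) | x <- equienergetic_codes & x.2 == l]].

Lemma card_code_class l :
  #|code_class l| = count (fun x => x.2 == l) equienergetic_codes.
Proof.
rewrite cardsE; set s := map _ _; have /card_uniqP -> : uniq s.
  rewrite map_inj_in_uniq ?filter_uniq //.
  move=> x y; rewrite !mem_filter => /andP[_ xe] /andP[_ ye] /iso_class_inj.
  exact: equienergetic_code_graph_inj.
by rewrite size_map size_filter.
Qed.

Lemma classes_code_graph x : x \in equienergetic_codes ->
  classes_with_local_energy 6 (local_energy R (code_graph x)) = code_class x.2.
Proof.
move=> xe; apply/setP => Y; rewrite inE; apply/imsetP/mapP.
  case=> G; rewrite inE => /eqP Gx ->.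
  have [y yall Gy] := code_graph_complete G.
  exists y; last exact: eq_iso_class.
  have xall : x \in all_codes by rewrite mem_cat xe.
  rewrite mem_filter; have := same_local_energy xall yall.
  rewrite -Gx (local_energy_iso R Gy).
  by move=> /(_ erefl)[<-|[_ -> ->]]; rewrite eqxx.
case=> y; rewrite mem_filter => /andP[/eqP yx ye] ->.
exists (code_graph y) => //.
by rewrite inE; apply/eqP/local_energy_code_graph.
Qed.

Lemma code_class_equienergetic x : x \in equienergetic_codes ->
  code_class x.2 \in locally_equienergetic_classes R 6.
Proof.
move=> xe; rewrite inE -{1}classes_code_graph // imset_f //= card_code_class.
by move: x xe; apply/allP; vm_compute.
Qed.

Lemma locally_equienergetic_classesP X :
  reflect (exists2 x, x \in equienergetic_codes & X = code_class x.2)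
          (X \in locally_equienergetic_classes R 6).
Proof.
apply: (iffP idP) => [|[x xe ->]]; last exact: code_class_equienergetic.
rewrite inE => /andP[/imsetP[G _ ->] /card_gt1P[Y1 [Y2 [GY1 GY2]]]].
case/imsetP: GY1 => H1; rewrite inE => /eqP e1 ->.
case/imsetP: GY2 => H2; rewrite inE => /eqP e2 -> neqH.
have [x xall H1x] := code_graph_complete H1.
have [y yall H2y] := code_graph_complete H2.
have [|xy|[xe _ _]] := same_local_energy xall yall.
- apply: etrans (esym (local_energy_iso R H1x)) _.
  exact (etrans (etrans e1 (esym e2)) (local_energy_iso R H2y)).
- case/eqP: neqH; apply: eq_iso_class; apply: graph_iso_trans H1x _.
  by rewrite xy; apply: graph_iso_sym.
rewrite -e1 (local_energy_iso R H1x).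
exact (ex_intro2 _ _ x xe (classes_code_graph xe)).
Qed.

End Classification.

Lemma code_classE l s :
  [seq x <- equienergetic_codes | x.2 == l] = s ->
  code_class l = [set Y in [seq iso_class 6 (code_graph x) | x <- s]].
Proof. by move=> <-. Qed.

Lemma code_class_neq (R : rcfType) l m :
  count (fun x => x.2 == l) equienergetic_codes !=
    count (fun x => x.2 == m) equienergetic_codes ->
  code_class l != code_class m.
Proof. by apply: contra => /eqP lm; rewrite -!(card_code_class R) lm. Qed.

(** * The nine graphs of the statement *)

Lemma iso_code_graph (T : finType) (G : sgraph T) n e x :
  graph_iso G (ngraph n e) -> n = 6 ->
  encode 6 (adjacent e) = encode 6 (adjacent (code_rel x.1)) ->
  graph_iso G (code_graph x).
Proof.
by move=> Ge n6; rewrite n6 in Ge; rewrite /code_graph => /eq_ngraph <-.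
Qed.

Definition equienergetic (k : nat) := nth (Z0, Z0) equienergetic_codes k.

Lemma mem_equienergetic k :
  k < size equienergetic_codes -> equienergetic k \in equienergetic_codes.
Proof. exact: mem_nth. Qed.

Local Notation K := complete_ngraph.
Local Notation union := disjoint_union_iso.

Lemma K6_iso :
  graph_iso 'K_6 (code_graph (equienergetic 0)).
Proof.
by apply: (iso_code_graph (K 6)) => //; vm_compute.
Qed.

Lemma K4_K2_iso :
  graph_iso ('K_4 ∪ 'K_2) (code_graph (equienergetic 1)).
Proof.
by apply: (iso_code_graph (union (K 4) (K 2))) => //; vm_compute.
Qed.

Lemma K3_K3_iso :
  graph_iso ('K_3 ∪ 'K_3) (code_graph (equienergetic 2)).
Proof.
by apply: (iso_code_graph (union (K 3) (K 3))) => //; vm_compute.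
Qed.

Lemma K2_K2_K2_iso :
  graph_iso ('K_2 ∪ 'K_2 ∪ 'K_2) (code_graph (equienergetic 3)).
Proof.
by apply: (iso_code_graph (union (union (K 2) (K 2)) (K 2))) => //; vm_compute.
Qed.

Lemma K5_K1_iso :
  graph_iso ('K_5 ∪ 'K_1) (code_graph (equienergetic 4)).
Proof.
by apply: (iso_code_graph (union (K 5) (K 1))) => //; vm_compute.
Qed.

Lemma K3_K2_K1_iso :
  graph_iso ('K_3 ∪ 'K_2 ∪ 'K_1) (code_graph (equienergetic 5)).
Proof.
by apply: (iso_code_graph (union (union (K 3) (K 2)) (K 1))) => //; vm_compute.
Qed.

Lemma C5_K1_iso :
  graph_iso ('Cyc_5 ∪ 'K_1) (code_graph (equienergetic 6)).
Proof.
by apply: (iso_code_graph (union (cycle_ngraph 5) (K 1))) => //; vm_compute.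
Qed.

Lemma K4_K1_K1_iso :
  graph_iso ('K_4 ∪ 'K_1 ∪ 'K_1) (code_graph (equienergetic 7)).
Proof.
by apply: (iso_code_graph (union (union (K 4) (K 1)) (K 1))) => //; vm_compute.
Qed.

Lemma K2_K2_K1_K1_iso :
  graph_iso ('K_2 ∪ 'K_2 ∪ 'K_1 ∪ 'K_1) (code_graph (equienergetic 8)).
Proof.
by apply: (iso_code_graph (union (union (union (K 2) (K 2)) (K 1)) (K 1)));
  rewrite //; vm_compute.
Qed.

Theorem proposition5 (R : realType) :
  let C1 := [set iso_class 6 'K_6;
                 iso_class 6 ('K_4 ∪ 'K_2);
                 iso_class 6 ('K_3 ∪ 'K_3);
                 iso_class 6 ('K_2 ∪ 'K_2 ∪ 'K_2)] in
  let C2 := [set iso_class 6 ('K_5 ∪ 'K_1);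
                 iso_class 6 ('K_3 ∪ 'K_2 ∪ 'K_1);
                 iso_class 6 ('Cyc_5 ∪ 'K_1)] in
  let C3 := [set iso_class 6 ('K_4 ∪ 'K_1 ∪ 'K_1);
                 iso_class 6 ('K_2 ∪ 'K_2 ∪ 'K_1 ∪ 'K_1)] in
  [/\ #|locally_equienergetic_classes R 6| = 3,
      locally_equienergetic_classes R 6 = [set C1; C2; C3],
      [/\ #|C1| = 4,
          local_energy R 'K_6 = local_energy R ('K_4 ∪ 'K_2),
          local_energy R ('K_4 ∪ 'K_2) = local_energy R ('K_3 ∪ 'K_3) &
          local_energy R ('K_3 ∪ 'K_3) = local_energy R ('K_2 ∪ 'K_2 ∪ 'K_2)],
      [/\ #|C2| = 3,
          local_energy R ('K_5 ∪ 'K_1) = local_energy R ('K_3 ∪ 'K_2 ∪ 'K_1) &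
          local_energy R ('K_3 ∪ 'K_2 ∪ 'K_1) = local_energy R ('Cyc_5 ∪ 'K_1)] &
      #|C3| = 2 /\
      local_energy R ('K_4 ∪ 'K_1 ∪ 'K_1) =
        local_energy R ('K_2 ∪ 'K_2 ∪ 'K_1 ∪ 'K_1)].
Proof.
move=> C1 C2 C3.
have C1E : C1 = code_class (equienergetic 0).2.
  rewrite (@code_classE _ [seq equienergetic k | k <- [:: 0; 1; 2; 3]]);
    last by vm_compute.
  apply/setP => Y; rewrite !inE -!orbA.
  rewrite (eq_iso_class 6 K6_iso) (eq_iso_class 6 K4_K2_iso).
  by rewrite (eq_iso_class 6 K3_K3_iso) (eq_iso_class 6 K2_K2_K2_iso).
have C2E : C2 = code_class (equienergetic 4).2.
  rewrite (@code_classE _ [seq equienergetic k | k <- [:: 4; 5; 6]]);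
    last by vm_compute.
  apply/setP => Y; rewrite !inE -!orbA (eq_iso_class 6 K5_K1_iso).
  by rewrite (eq_iso_class 6 K3_K2_K1_iso) (eq_iso_class 6 C5_K1_iso).
have C3E : C3 = code_class (equienergetic 7).2.
  rewrite (@code_classE _ [seq equienergetic k | k <- [:: 7; 8]]);
    last by vm_compute.
  apply/setP => Y; rewrite !inE (eq_iso_class 6 K4_K1_K1_iso).
  by rewrite (eq_iso_class 6 K2_K2_K1_K1_iso).
have classesE : locally_equienergetic_classes R 6 = [set C1; C2; C3].
  apply/setP => X; rewrite C1E C2E C3E !in_setU !in_set1 -orbA.
  apply/locally_equienergetic_classesP/or3P => [[x xe ->]|].
    have : x.2 \in [seq (equienergetic k).2 | k <- [:: 0; 4; 7]].
      by move: x xe; apply/allP; vm_compute.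
    by rewrite !inE => /or3P[]/eqP ->; [apply: Or31|apply: Or32|apply: Or33].
  by case=> /eqP ->;
    [exists (equienergetic 0)|exists (equienergetic 4)|exists (equienergetic 7)].
have same (T U : finType) (G : sgraph T) (H : sgraph U) j k :
    graph_iso G (code_graph (equienergetic j)) ->
    graph_iso H (code_graph (equienergetic k)) ->
    j < size equienergetic_codes -> k < size equienergetic_codes ->
    (equienergetic j).2 = (equienergetic k).2 ->
    local_energy R G = local_energy R H.
  move=> Gj Hk j9 k9 jk.
  rewrite (local_energy_iso R Gj) (local_energy_iso R Hk).
  by apply: local_energy_code_graph; rewrite ?mem_equienergetic.
split=> //.
- rewrite classesE C1E C2E C3E -setUA cardsU1 cards2 !inE negb_or.
  by rewrite !(code_class_neq R).
- split; first by rewrite C1E (card_code_class R).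
  + exact: same K6_iso K4_K2_iso _ _ _.
  + exact: same K4_K2_iso K3_K3_iso _ _ _.
  + exact: same K3_K3_iso K2_K2_K2_iso _ _ _.
- split; first by rewrite C2E (card_code_class R).
  + exact: same K5_K1_iso K3_K2_K1_iso _ _ _.
  + exact: same K3_K2_K1_iso C5_K1_iso _ _ _.
- split; first by rewrite C3E (card_code_class R).
  exact: same K4_K1_K1_iso K2_K2_K1_K1_iso _ _ _.
Qed.
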